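(* There exists an absolute constant $C>0$ such that for every graph $G=(V,E,\ell)$ with nonnegative edge lengths and every set $R\subseteq V$ of $k$ terminals, the output $G'$ of the procedure $\textsc{ReduceGraphNaive}(G,R)$ is a distance-preserving minor of $G$ with respect to $R$ with at most $C k^4$ vertices. In particular, $f^*(k)\le Ck^4$ for every $k\ge 1$.
   Context: All graphs are finite and undirected, with nonnegative edge lengths; $d_H$ denotes shortest-path distance in a graph $H$. Given a graph $G=(V,E,\ell)$ and terminals $R\subseteq V$, a distance-preserving minor of $G$ with respect to $R$ is a graph $G'$ with edge lengths $\ell'$ (which may differ from $\ell$) such that $G'$ is a minor of $G$ in which the terminals survive (terminals are never deleted and no two terminals are merged; a terminal may be merged with non-terminals by contraction and the resulting vertex is identified with that terminal), so $R\subseteq V(G')$, and $d_{G'}(u,v)=d_G(u,v)$ for all $u,v\in R$. $f^*(k)$ is the minimum number such that every graph with nonnegative edge lengths and $k$ terminals admits a distance-preserving minor with at most $f^*(k)$ vertices. The procedure $\textsc{ReduceGraphNaive}(G,R)$: (1) delete all non-terminal vertices and all edges that do not lie on any shortest path between two terminals; (2) while there is a non-terminal vertex $v$ incident to exactly two edges $(v,u)$ and $(v,w)$, contract the edge $(u,v)$ and set the length of the resulting edge $(u,w)$ to $d_G(u,w)$. The output is the resulting graph.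
   Formalization: With tied shortest paths the vertex bound fails if step (1) keeps everything on any shortest path; here step (1) keeps only what lies on terminal-to-terminal shortest paths chosen by a consistent tie-breaking rule (any such rule; the same procedure when shortest paths are unique). *)

(* Defs.v *)
From HB Require Import structures.
From mathcomp Require Import all_boot all_order all_algebra.
From mathcomp Require Import all_classical all_reals ereal.

Set Implicit Arguments.
Unset Strict Implicit.
Unset Printing Implicit Defensive.

Import Order.TTheory GRing.Theory Num.Theory.

Local Open Scope ring_scope.

(* The vertices form a subset of an ambient finite type, so that deleting a
   vertex, or merging it into another one, stays inside the same type; an edge
   is the two-element set of its endpoints. *)
Record sgraph (T : finType) : Type :=
  SGraph { vset : {set T} ; eset : {set {set T}} }.

Record graph (R : realType) (T : finType) : Type :=
  Graph { shape :> sgraph T ; len : {set T} -> R }.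

Section Graphs.
Variables (R : realType) (T : finType).
Implicit Types (G H : graph R T) (S : sgraph T) (A : {set T}).
Implicit Types (u v w x y : T) (s p : seq T).

(* Only the values of [len] on edges matter. *)
Definition is_graph G : Prop :=
  forall e : {set T}, e \in eset G ->
    [/\ #|e| = 2%N, e \subset vset G & 0 <= len G e].

Definition adj S : rel T := fun x y => [set x; y]%SET \in eset S.

(* A path is given by the sequence of all its vertices, both ends included. *)
Definition is_path S u v s : bool :=
  if s is x :: p then
    [&& x == u, x \in vset S, path (adj S) x p, last x p == v & uniq (x :: p)]
  else false.

Definition path_edges s : seq {set T} :=
  if s is x :: p then pairmap (fun a b => [set a; b]%SET) x p else [::].

Definition path_len G s : R := \sum_(e <- path_edges s) len G e.

(* Equal to +oo when no path joins u to v. *)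
Definition dist G u v : \bar R :=
  ereal_inf [set (path_len G s)%:E | s in [set s | is_path G u v s]]%classic.

Definition shortest_path G u v s : Prop :=
  is_path G u v s /\ (path_len G s)%:E = dist G u v.

Definition del_vertex v S : sgraph T :=
  SGraph (vset S :\ v) [set e in eset S | v \notin e]%SET.

Definition del_edge (e : {set T}) S : sgraph T :=
  SGraph (vset S) (eset S :\ e).

Definition merge u v x : T := if x == v then u else x.

(* Contraction of the edge {u, v}; the new vertex is called u.  The loop is
   dropped and parallel edges are identified. *)
Definition contract u v S : sgraph T :=
  SGraph (vset S :\ v)
    [set f in [set merge u v @: e | e : {set T} in eset S] | #|f| == 2%N]%SET.

(* One minor operation keeping the terminals A: the vertex v that disappears
   is never a terminal, while u may be one. *)
Inductive minor_step A S : sgraph T -> Prop :=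
| MinorDelVertex v : v \in vset S -> v \notin A ->
    minor_step A S (del_vertex v S)
| MinorDelEdge e : e \in eset S -> minor_step A S (del_edge e S)
| MinorContract u v : [set u; v]%SET \in eset S -> v \notin A ->
    minor_step A S (contract u v S).

Inductive terminal_minor A S : sgraph T -> Prop :=
| MinorRefl : terminal_minor A S S
| MinorTrans S1 S2 : terminal_minor A S S1 -> minor_step A S1 S2 ->
    terminal_minor A S S2.

Definition distance_preserving_minor G A G' : Prop :=
  [/\ is_graph G', terminal_minor A G G', A \subset vset G' &
      forall u v, u \in A -> v \in A -> dist G' u v = dist G u v].

(* Shortest paths need not be unique.  As is customary for this procedure,
   "the" shortest paths are those selected by a consistent tie-breaking rule:
   one shortest path P u v for each connected pair, the same in both directions
   and such that any segment of a selected path is selected.  Without a choice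
   the size bound would fail: in the graph with unit edges s-a_i, a_i-b_j and
   b_j-t (1 <= i, j <= n), every edge lies on a shortest path from s to t, and
   all the a_i and b_j have degree n+1.  [P u v = [::]] means that u and v are
   not connected. *)
Definition consistent_shortest_paths G (P : T -> T -> seq T) : Prop :=
  [/\ forall u v, (exists s, is_path G u v s) -> shortest_path G u v (P u v),
      forall u v, ~ (exists s, is_path G u v s) -> P u v = [::],
      forall u v, P v u = rev (P u v) &
      forall u v x s, infix (x :: s) (P u v) -> P x (last x s) = x :: s].

Definition prune G A (P : T -> T -> seq T) : graph R T :=
  Graph
    (SGraph
      [set x in vset G | (x \in A) ||
         [exists u in A, exists v in A, x \in P u v]]%SET
      [set e in eset G |
         [exists u in A, exists v in A, e \in path_edges (P u v)]]%SET)
    (len G).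

(* One iteration of the loop on the current graph H, started from the input G;
   the new length is the distance in the input graph. *)
Inductive smooth_step G A H : graph R T -> Prop :=
| SmoothStep u v w :
    v \in vset H -> v \notin A -> u != w ->
    [set e in eset H | v \in e]%SET = [set [set v; u]; [set v; w]]%SET ->
    smooth_step G A H
      (Graph (contract u v H)
         (fun e => if e == [set u; w]%SET then fine (dist G u w)
                   else len H e)).

Inductive smooth_loop G A H : graph R T -> Prop :=
| SmoothExit : (forall H', ~ smooth_step G A H H') -> smooth_loop G A H H
| SmoothIter H' H'' : smooth_step G A H H' -> smooth_loop G A H' H'' ->
    smooth_loop G A H H''.

(* G' is an output of ReduceGraphNaive on (G, A), for some run: the
   tie-breaking rule, the order of the contractions and the choice of the
   contracted edge at each step are all free. *)
Definition reduce_graph_naive G A G' : Prop :=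
  exists2 P : T -> T -> seq T, consistent_shortest_paths G P &
    smooth_loop G A (prune G A P) G'.

(* When shortest paths are unique, the pruning keeps exactly the terminals and
   what lies on some shortest path between two terminals. *)
Lemma prune_unique G A P :
  (forall u v s s', shortest_path G u v s -> shortest_path G u v s' -> s = s') ->
  consistent_shortest_paths G P ->
  (forall x, (x \in vset (prune G A P)) <->
     x \in vset G /\ (x \in A \/ exists u v s,
       [/\ u \in A, v \in A, shortest_path G u v s & x \in s])) /\
  (forall e, (e \in eset (prune G A P)) <->
     e \in eset G /\ exists u v s,
       [/\ u \in A, v \in A, shortest_path G u v s & e \in path_edges s]).
Proof.
move=> uG [Psp P0 _ _].
have PE u v s : shortest_path G u v s -> s = P u v.
  by move=> sp; apply: (uG u v) => //; apply: Psp; exists s; case: sp.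
have PS u v : P u v <> [::] -> shortest_path G u v (P u v).
  by move=> Pn; apply: Psp; apply: contrapT => /P0.
split=> z; rewrite inE; split.
- case/andP=> -> /orP[->|]; first by split=> //; left.
  case/existsP=> u /andP[uA] /existsP[v /andP[vA zP]]; split=> //; right.
  exists u, v, (P u v); split=> //; apply: PS => P_nil.
  by rewrite P_nil in zP.
- case=> -> [->//|[u [v [s [uA vA sp zs]]]]]; apply/orP; right.
  apply/existsP; exists u; rewrite uA; apply/existsP; exists v.
  by rewrite vA -(PE _ _ _ sp).
- case/andP=> -> /existsP[u /andP[uA] /existsP[v /andP[vA zP]]]; split=> //.
  exists u, v, (P u v); split=> //; apply: PS => P_nil.
  by rewrite P_nil in zP.
- case=> -> [u [v [s [uA vA sp zs]]]].
  apply/existsP; exists u; rewrite uA; apply/existsP; exists v.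
  by rewrite vA -(PE _ _ _ sp).
Qed.

End Graphs.

Definition minor_size_bound (R : realType) (k m : nat) : Prop :=
  forall (T : finType) (G : graph R T) (A : {set T}),
    is_graph G -> A \subset vset G -> #|A| = k ->
    exists2 G' : graph R T,
      distance_preserving_minor G A G' & (#|vset G'| <= m)%N.

(* m is the value of f*(k). *)
Definition is_fstar (R : realType) (k m : nat) : Prop :=
  minor_size_bound R k m /\
  forall m' : nat, minor_size_bound R k m' -> (m <= m')%N.

(* Main.v *)
(* Breaking ties between shortest paths by an injective weight on edge sets gives
   a consistent choice P of shortest paths.  Along the loop, the current graph
   consists of the traces on its vertex set of the paths P a b between
   terminals, and each of its edges is as long as the distance in G between its
   endpoints; this preserves the distances between terminals.  By consistency,
   two traces share a segment.  When the loop stops, two traces diverge at every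
   non-terminal, which is therefore the first or the last vertex shared by some
   pair of traces: there are at most 2 k^4 of them. *)

Require Import Defs.
From mathcomp Require Import all_boot all_order all_algebra.
From mathcomp Require Import all_classical all_reals.
From mathcomp Require Import ereal.

Set Implicit Arguments.
Unset Strict Implicit.
Unset Printing Implicit Defensive.

Import Order.TTheory GRing.Theory Num.Theory.

Local Open Scope ring_scope.

(** * Vertex sequences and their edges *)

Section Sequences.
Variable T : finType.
Implicit Types (x y u v w : T) (s p l r : seq T) (e : {set T}).

(** The ends are read with defaults a and b, so the hypotheses also hold for the empty sequence,
    which stands for an unconnected pair. *)
Lemma split_interior s a b v :
  head a s = a -> last b s = b -> v != a -> v != b -> v \in s ->
  exists l u w r, s = l ++ [:: u, v, w & r].
Proof.
move=> Ha Hb va vb vs; case/splitPr: vs Ha Hb => l r.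
case/lastP: l => [|l u] /=; first by move/eqP; rewrite (negPf va).
case: r => [|w r]; first by rewrite last_cat /= => _ /eqP; rewrite (negPf vb).
by move=> _ _; exists l, u, w, r; rewrite cat_rcons.
Qed.

Lemma path_edges_cat l x r :
  path_edges (l ++ x :: r) = path_edges (rcons l x) ++ path_edges (x :: r).
Proof. by case: l => //= y l; rewrite -cat_rcons pairmap_cat last_rcons. Qed.

Lemma path_edges_cons2 x y r :
  path_edges [:: x, y & r] = [set x; y]%SET :: path_edges (y :: r).
Proof. by []. Qed.

Lemma path_edges_cat2 l x y r :
  path_edges (l ++ [:: x, y & r]) =
  path_edges (rcons l x) ++ [set x; y]%SET :: path_edges (y :: r).
Proof. by rewrite path_edges_cat. Qed.

Lemma path_edges_infix l x s r :
  path_edges (l ++ (x :: s) ++ r) =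
  path_edges (rcons l x) ++ path_edges (x :: s) ++ path_edges (last x s :: r).
Proof.
rewrite /= path_edges_cat; congr (_ ++ _).
by rewrite /= pairmap_cat.
Qed.

Lemma path_edges_rev s : path_edges (rev s) = rev (path_edges s).
Proof.
elim: s => // x [|y s] IH //.
rewrite path_edges_cons2 !rev_cons -IH rev_cons -!cats1 -catA /=.
by rewrite path_edges_cat2 !cats1 /= finset.setUC.
Qed.

Lemma mem_path_edges e s :
  e \in path_edges s ->
  exists l x y r, s = l ++ [:: x, y & r] /\ e = [set x; y]%SET.
Proof.
elim: s => // x [|y s] IH //.
rewrite path_edges_cons2 inE => /orP[/eqP->|/IH [l [x' [y' [r [-> ->]]]]]].
  by exists [::], x, y, s.
by exists (x :: l), x', y', r.
Qed.

Lemma mem_path_edges_cat2 l x y r :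
  [set x; y]%SET \in path_edges (l ++ [:: x, y & r]).
Proof. by rewrite path_edges_cat2 mem_cat inE eqxx orbT. Qed.

Lemma path_edges_mem e s x : e \in path_edges s -> x \in e -> x \in s.
Proof.
case/mem_path_edges=> l [y [z [r [-> ->]]]]; rewrite !inE mem_cat !inE.
by case/orP=> /eqP->; rewrite eqxx ?orbT.
Qed.

Lemma card_path_edges s e : uniq s -> e \in path_edges s -> #|e| = 2%N.
Proof.
move=> U /mem_path_edges[l [x [y [r [E ->]]]]]; move: U.
rewrite E cat_uniq cards2 => /and3P[_ _]; rewrite cons_uniq inE negb_or.
by case/andP=> /andP[->].
Qed.

(** Without repetition v occurs neither up to u nor from w on, so only the two edges next to it
    contain it. *)
Lemma path_edges_at l u v w r e :
  uniq (l ++ [:: u, v, w & r]) -> e \in path_edges (l ++ [:: u, v, w & r]) ->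
  v \in e -> e = [set v; u]%SET \/ e = [set v; w]%SET.
Proof.
move=> U; rewrite path_edges_cat2 mem_cat inE path_edges_cons2 inE => He ve.
have [vl vr] : v \notin rcons l u /\ v \notin w :: r.
  move: U; rewrite -cat_rcons cat_uniq /= => /and3P[_].
  by rewrite negb_or => /andP[-> _] /andP[-> _].
case/or4P: He => [/path_edges_mem/(_ ve)|/eqP->|/eqP->|/path_edges_mem/(_ ve)].
- by rewrite (negPf vl).
- by left; rewrite finset.setUC.
- by right.
- by rewrite (negPf vr).
Qed.

(** This is the effect on one path of contracting an edge at v; [mem_contract] is its counterpart
    for the whole graph. *)
Lemma path_edges_bypass l u v w r e :
  uniq (l ++ [:: u, v, w & r]) ->
  (e \in path_edges [seq x <- l ++ [:: u, v, w & r] | x != v]) =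
  (e == [set u; w]%SET) ||
  (e \in path_edges (l ++ [:: u, v, w & r])) && (v \notin e).
Proof.
move=> U.
have [vl vu vw vr] : [/\ v \notin l, u != v, w != v & v \notin r].
  move: U; rewrite -cat_rcons cat_uniq /= mem_rcons !inE !negb_or.
  case/and3P=> _ /andP[/andP[vu vl] _] /andP[/andP[vw vr] _].
  by rewrite vl vr (eq_sym u) (eq_sym w) vu vw.
have notin s : v \notin s -> [seq x <- s | x != v] = s.
  move=> vs; apply/all_filterP/allP=> x xs; apply/eqP=> xv.
  by rewrite -xv xs in vs.
rewrite filter_cat /= vu vw eqxx /= !notin // !path_edges_cat2 !mem_cat.
rewrite path_edges_cons2 !inE.
have nl : e \in path_edges (rcons l u) -> v \notin e.
  move=> H; apply/negP=> /(path_edges_mem H).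
  by rewrite mem_rcons inE eq_sym (negPf vu) (negPf vl).
have nr : e \in path_edges (w :: r) -> v \notin e.
  move=> H; apply/negP=> /(path_edges_mem H).
  by rewrite inE eq_sym (negPf vw) (negPf vr).
case: (boolP (e \in path_edges (rcons l u))) => [/nl->|_] /=; first by rewrite orbT.
case: (boolP (e \in path_edges (w :: r))) => [/nr->|_] /=; first by rewrite !orbT.
rewrite !orbF; case: eqP => //= _.
by case: eqP => [->|_]; last case: eqP => [->|_] //; rewrite !inE eqxx ?orbT.
Qed.

(** Loop erasure. The list q collects the edges dropped with the loops, so that any nonnegative sum
    over edges can be compared before and after. *)
Lemma walk_shorten (E : rel T) x p :
  path E x p -> exists p' q,
  [/\ path E x p', last x p' = last x p, uniq (x :: p') &
      perm_eq (path_edges (x :: p)) (path_edges (x :: p') ++ q)].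
Proof.
elim: p x => [|y p IH] x; first by exists [::], [::].
rewrite [path _ _ _]/= => /andP[xy /IH[p' [q [Ep' Lp' Up' perm_p]]]].
case: (boolP (x \in y :: p')) => xp; last first.
  exists (y :: p'), q; split=> //=; first by rewrite xy.
    by rewrite xp.
  by rewrite perm_cons.
case/splitPr: {-1}_ / xp (erefl (y :: p')) => l r Elr.
(* The loop runs from x through y and l back to x; its edges join the discarded ones. *)
exists r, ([set x; y]%SET :: path_edges (rcons l x) ++ q).
have Ep : path E y p' by [].
have Pr : path E x r /\ last x r = last y p'.
  case: l Elr => [|z l] /= [yx Ep'E]; first by rewrite -Ep'E -yx.
  by move: Ep; rewrite Ep'E cat_path last_cat /= => /and3P[].
split; [by case: Pr | by case: Pr => _ ->; exact: Lp'| |].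
  by move: Up'; rewrite Elr cat_uniq => /and3P[].
rewrite path_edges_cons2 -[_ :: _ ++ q]cat1s perm_sym perm_catCA /= perm_cons.
by rewrite perm_catCA perm_sym catA -path_edges_cat -Elr.
Qed.

(** The first edge is the only one that contains x, so the edge set determines the second vertex;
    the argument then continues from there. *)
Lemma eq_path_edges x p p' :
  uniq (x :: p) -> uniq (x :: p') ->
  path_edges (x :: p) =i path_edges (x :: p') -> p = p'.
Proof.
elim: p x p' => [|y p IH] x [|y' p'] //.
- by move=> _ _ /(_ [set x; y']%SET); rewrite path_edges_cons2 !inE eqxx.
- by move=> _ _ /(_ [set x; y]%SET); rewrite path_edges_cons2 !inE eqxx.
move=> U U' E.
have yy' : y = y'.
  have := E [set x; y]%SET; rewrite !path_edges_cons2 !inE eqxx /=.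
  move/esym/orP=> [/eqP/setP/(_ y)|]; rewrite ?inE ?eqxx.
    rewrite orbT => /esym/orP[]/eqP// yx.
    by move: U; rewrite yx /= inE eqxx.
  move/(@path_edges_mem _ (y' :: p') x)/(_ (finset.set21 _ _)).
  by move: U'; rewrite cons_uniq => /andP[/negPf->].
rewrite -yy' in U' E *; congr (_ :: _); apply: (IH y).
- by case/andP: U.
- by case/andP: U'.
move=> e; have := E e; rewrite !path_edges_cons2 !inE.
case: eqP => // -> _.
have no s : uniq [:: x, y & s] -> [set x; y]%SET \in path_edges (y :: s) = false.
  rewrite cons_uniq => /andP[xs _]; apply/negP.
  by move/path_edges_mem/(_ (finset.set21 _ _)); rewrite (negPf xs).
by rewrite !no.
Qed.

End Sequences.

(** Uniqueness of binary expansions: parity gives the lowest digit, and halving shifts the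
    others. *)
Lemma binary_inj n (f g : nat -> bool) :
  (\sum_(i < n) f i * 2 ^ i = \sum_(i < n) g i * 2 ^ i)%N ->
  forall i, (i < n)%N -> f i = g i.
Proof.
elim: n f g => // n IH f g.
have shift (h : nat -> bool) : (\sum_(i < n.+1) h i * 2 ^ i =
    h 0 + (\sum_(i < n) h i.+1 * 2 ^ i).*2)%N.
  rewrite big_ord_recl /= muln1 -muln2 big_distrl /=; congr addn.
  by apply: eq_bigr => i _; rewrite /bump /= expnS -mulnA (mulnC 2).
rewrite !shift => E.
have E0 : f 0 = g 0.
  by have := congr1 odd E; rewrite !oddD !odd_double !addbF !oddb.
move: E; rewrite E0 => /addnI/double_inj/(IH (f \o succn) (g \o succn)) H [|i]; first by [].
by rewrite ltnS => /H.
Qed.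


(** * Walks and paths in a graph *)

Section Walks.
Variables (R : realType) (T : finType).
Implicit Types (G H : graph R T) (x y u v : T) (s p l r : seq T).

Lemma is_pathP (S : sgraph T) u v s :
  is_path S u v s <-> exists p,
    [/\ s = u :: p, u \in vset S, path (adj S) u p, last u p = v & uniq s].
Proof.
split; last by case=> p [-> uS Ep <- U]; rewrite /is_path eqxx uS Ep eqxx.
by case: s => // x p /and5P[/eqP<- xS Ep /eqP<- U]; exists p.
Qed.

Lemma adj_path_edges (S : sgraph T) x p :
  path (adj S) x p = all (mem (eset S)) (path_edges (x :: p)).
Proof. by elim: p x => //= y p IH x; rewrite IH. Qed.

Lemma adj_sym (S : sgraph T) : symmetric (adj S).
Proof. by move=> x y; rewrite /adj finset.setUC. Qed.

Lemma path_in_vset G u v s :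
  is_graph G -> is_path G u v s -> {subset s <= vset G}.
Proof.
move=> gG /is_pathP[p [-> uG Ep _ _]] x; rewrite inE => /orP[/eqP->//|].
elim: p u uG Ep => //= y p IH u uG /andP[uy Ep].
have yG : y \in vset G.
  by have [_ /fintype.subsetP S _] := gG _ uy; rewrite S // finset.set22.
by rewrite inE => /orP[/eqP->//|]; apply: (IH y).
Qed.

Lemma is_path_rev G u v s :
  is_graph G -> is_path G u v s -> is_path G v u (rev s).
Proof.
move=> gG Ps; have sG := path_in_vset gG Ps.
case/is_pathP: Ps => p [Es uG Ep Lp U]; apply/is_pathP.
exists (rev (belast u p)); rewrite Es -Lp -rev_rcons -lastI -Es rev_uniq.
split=> //.
- by rewrite sG // Es mem_last.
- by rewrite rev_path; under eq_path => a b do rewrite adj_sym.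
- by case: (p) => //= y q; rewrite rev_cons last_rcons.
Qed.

Lemma is_path_infix G u v l x s r :
  is_graph G -> is_path G u v (l ++ (x :: s) ++ r) ->
  is_path G x (last x s) (x :: s).
Proof.
move=> gG Ps; have sG := path_in_vset gG Ps.
case/is_pathP: Ps => p [Es uG Ep Lp U]; apply/is_pathP; exists s; split=> //.
- by rewrite sG // !(mem_cat, inE) eqxx orbT.
- move: Ep; rewrite !adj_path_edges -Es path_edges_infix !all_cat.
  by case/and3P.
- by move: U; rewrite !cat_uniq => /and3P[_ _ /and3P[]].
Qed.

Lemma path_len_infix G l x s r :
  path_len G (l ++ (x :: s) ++ r) =
  path_len G (rcons l x) + path_len G (x :: s) + path_len G (last x s :: r).
Proof. by rewrite /path_len path_edges_infix !big_cat /= addrA. Qed.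

Lemma path_len_rev G s : path_len G (rev s) = path_len G s.
Proof.
rewrite /path_len path_edges_rev; apply: perm_big.
by rewrite perm_rev.
Qed.

(** Loop erasure drops only edges of nonnegative length. A single path serves the length and all
    weights w at once, as a lexicographic comparison requires. *)
Lemma walk_to_path G x p :
  is_graph G -> x \in vset G -> path (adj G) x p ->
  exists2 s, is_path G x (last x p) s &
    path_len G s <= path_len G (x :: p) /\
    forall w : {set T} -> nat, (\sum_(e <- path_edges s) w e <=
      \sum_(e <- path_edges (x :: p)) w e)%N.
Proof.
move=> gG xG Ep; have [p' [q [Ep' Lp' Up' perm_p]]] := walk_shorten Ep.
exists (x :: p'); first by apply/is_pathP; exists p'.
split=> [|w]; last by rewrite (perm_big _ perm_p) big_cat /= leq_addr.
rewrite /path_len (perm_big _ perm_p) big_cat /= lerDl big_seq.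
apply: sumr_ge0 => e eq; have [] // := gG e.
move: Ep; rewrite adj_path_edges => /allP; apply.
by rewrite (perm_mem perm_p) mem_cat eq orbT.
Qed.

End Walks.

(** * Consistent choice of shortest paths *)

Section TieBreaking.
Variables (R : realType) (T : finType) (G : graph R T).
Hypothesis gG : is_graph G.
Implicit Types (x y u v : T) (s p l r : seq T).

(* Distinct edge sets have distinct binary weights, so minimizing first the
   length and then the weight selects a unique path. *)
Let weight s : nat := (\sum_(e <- path_edges s) 2 ^ enum_rank e)%N.

Let lex_le s s' :=
  path_len G s < path_len G s' \/
  path_len G s = path_len G s' /\ (weight s <= weight s')%N.

Let best u v s :=
  is_path G u v s /\ forall s', is_path G u v s' -> lex_le s s'.

(** Paths do not repeat vertices, so they live in the finite type of sequences of size at most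
    [#|T|]. The length is minimized there, then the weight among the shortest paths. *)
Lemma best_exists u v : (exists s, is_path G u v s) -> exists s, best u v s.
Proof.
case=> s0 Ps0.
have size_path s : is_path G u v s -> (size s <= #|T|)%N.
  by case/is_pathP=> p [_ _ _ _ U]; rewrite -(card_uniqP U) max_card.
pose b0 : #|T|.-bseq T := Bseq (size_path _ Ps0).
have [b Pb min_b] := @arg_minP _ _ _ b0
  (fun b : #|T|.-bseq T => is_path G u v b) (fun b => path_len G b) Ps0.
pose W n := `[< exists s, [/\ is_path G u v s, path_len G s = path_len G b &
                              weight s = n] >].
have exW : exists n, W n by exists (weight b); apply/asboolP; exists b.
have [n /asboolP[s [Ps Ls <-]] min_n] := ex_minnP exW.
exists s; split=> // s' Ps'; rewrite /lex_le Ls.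
have := min_b (Bseq (size_path _ Ps')) Ps'.
rewrite /= le_eqVlt => /orP[/eqP E|->]; last by left.
by right; split=> //; apply: min_n; apply/asboolP; exists s'.
Qed.

(** When no edge repeats, the weight is the binary number whose digit at position [enum_rank e]
    tells whether e is used. *)
Lemma sum_weight_inj s s' :
  uniq (path_edges s) -> uniq (path_edges s') -> weight s = weight s' ->
  path_edges s =i path_edges s'.
Proof.
move=> U U'; pose f (t : seq T) i := has (fun e => enum_rank e == i :> nat) (path_edges t).
have fE (t : seq T) e : f t (enum_rank e) = (e \in path_edges t).
  apply/hasP/idP => [[e' e't /eqP/ord_inj/enum_rank_inj <-]//|et].
  by exists e.
have wE (t : seq T) : uniq (path_edges t) ->
    weight t = (\sum_(i < #|{set T}|) f t i * 2 ^ i)%N.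
  move=> Ut; rewrite /weight (big_uniq _ Ut) /= big_mkcond.
  rewrite (reindex _ (onW_bij _ (@enum_val_bij _))) /=.
  apply: eq_bigr => i _; rewrite -[in f t i](enum_valK i) fE enum_valK.
  by case: ifP; rewrite ?mul1n.
rewrite !wE // => /binary_inj E e; rewrite -!fE; apply: E.
exact: ltn_ord.
Qed.

Lemma uniq_path_edges s : uniq s -> uniq (path_edges s).
Proof.
elim: s => // x [|y s] IH //; rewrite cons_uniq path_edges_cons2 => /andP[xs U].
rewrite cons_uniq IH // andbT; apply: contra xs.
by move/path_edges_mem; apply; rewrite finset.set21.
Qed.

(** Two optimal paths have equal weights, hence the same edges, and both start at u. *)
Lemma best_unique u v s s' : best u v s -> best u v s' -> s = s'.
Proof.
move=> [Ps bs] [Ps' bs'].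
have W : weight s = weight s'.
  case: (bs _ Ps') => [lt|[E le]]; case: (bs' _ Ps) => [lt'|[E' le']].
  - by move: (lt_trans lt lt'); rewrite ltxx.
  - by move: lt; rewrite E' ltxx.
  - by move: lt'; rewrite E ltxx.
  - by apply/eqP; rewrite eqn_leq le le'.
case/is_pathP: Ps W => p [-> _ _ _ U]; case/is_pathP: Ps' => p' [-> _ _ _ U'] W.
congr (_ :: _); apply: (@eq_path_edges _ u) => //.
by apply: sum_weight_inj => //; apply: uniq_path_edges.
Qed.

Lemma best_rev u v s : best u v s -> best v u (rev s).
Proof.
have wrev t : weight (rev t) = weight t.
  by rewrite /weight path_edges_rev; apply: perm_big; rewrite perm_rev.
move=> [Ps bs]; split=> [|t /(is_path_rev gG)/bs]; first exact: is_path_rev.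
by rewrite /lex_le !path_len_rev !wrev.
Qed.

(* Replacing a segment of an optimal path by a better one gives a better walk,
   hence a better path. *)
Lemma best_infix u v l x s r :
  best u v (l ++ (x :: s) ++ r) -> best x (last x s) (x :: s).
Proof.
move=> [Pu bu]; have Ps := is_path_infix gG Pu.
have [q [Pq bq]] : exists q, best x (last x s) q.
  by apply: best_exists; exists (x :: s).
have {}Pqu := Pq; case/is_pathP: Pqu => p [Eq _ Ep Lp _].
(* With q in place of the segment one gets a walk that may revisit vertices; t is a path extracted
   from it. *)
have [t Pt [Lt Wt]] : exists2 t, is_path G u v t &
    path_len G t <= path_len G (l ++ q ++ r) /\
    (weight t <= weight (l ++ q ++ r))%N.
  case/is_pathP: Pu => p0 [E0 uG Ep0 Lp0 _].
  have [p1 E1] : exists p1, l ++ q ++ r = u :: p1.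
    case: (l) E0 => [|z l'] /= [<- _]; last by exists (l' ++ q ++ r).
    by rewrite Eq; exists (p ++ r).
  have Ep1 : path (adj G) u p1.
    move: Ep0; rewrite !adj_path_edges -E0 -E1 Eq !path_edges_infix !all_cat Lp.
    by case/and3P=> -> _ ->; rewrite -adj_path_edges Ep.
  have Lp1 : last u p1 = v.
    have := congr1 (last u) E1; have := congr1 (last u) E0.
    by rewrite Eq /= !last_cat /= !last_cat Lp => -> <-.
  have [t Pt [Lt Wt]] := walk_to_path gG uG Ep1.
  exists t; first by rewrite -Lp1.
  by rewrite E1; split=> //; apply: Wt.
have weight_infix a b y m : weight (a ++ (y :: m) ++ b) =
    (weight (rcons a y) + weight (y :: m) + weight (last y m :: b))%N.
  by rewrite /weight path_edges_infix !big_cat /= addnA.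
(* Since q is no longer than the segment, optimality of the whole path against t forces equal
   lengths and then compares the weights. *)
have [Lqs Wqs] : path_len G (x :: s) = path_len G q /\
    (weight (x :: s) <= weight q)%N.
  move: Lt Wt; rewrite Eq path_len_infix weight_infix Lp -Eq => Lt Wt.
  have Lsq : path_len G q <= path_len G (x :: s).
    by case: (bq _ Ps) => [/ltW|[-> _]].
  move: (bu _ Pt); rewrite /lex_le path_len_infix weight_infix.
  case=> [/lt_le_trans/(_ Lt)|[E W]].
    by rewrite ltrD2r ltrD2l ltNge Lsq.
  split; last by move: (leq_trans W Wt); rewrite leq_add2r leq_add2l.
  by apply: le_anti; rewrite Lsq -E lerD2r lerD2l in Lt *; rewrite Lt.
split=> // s' /bq; rewrite /lex_le Lqs => -[|[-> W]]; first by left.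
by right; split=> //; apply: leq_trans W.
Qed.

Lemma dist_attained u v s :
  is_path G u v s -> (forall s', is_path G u v s' -> path_len G s <= path_len G s') ->
  dist G u v = (path_len G s)%:E.
Proof.
move=> Ps min_s; apply/eqP; rewrite eq_le; apply/andP; split.
  by apply: ereal_inf_lbound; exists s.
by apply: le_ereal_inf_tmp => _ [s' Ps' <-]; rewrite lee_fin min_s.
Qed.

(** Reversals and segments of optimal paths are optimal; uniqueness turns this into the two required
    equalities. *)
Lemma consistent_shortest_paths_exist :
  exists P, consistent_shortest_paths G P.
Proof.
(* The default [[::]] is the value prescribed for unconnected pairs. *)
pose P u v := xget [::] [set s | best u v s]%classic.
have PP u v : (exists s, is_path G u v s) -> best u v (P u v).
  by case/best_exists=> s bs; apply: (xgetPex [::]); exists s.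
have P0 u v : ~ (exists s, is_path G u v s) -> P u v = [::].
  by move=> nP; apply: xgetPN => s [Ps _]; apply: nP; exists s.
exists P; split=> //.
- move=> u v /PP[Ps bs]; split=> //; apply/esym/dist_attained => // s' /bs.
  by case=> [/ltW|[-> _]].
- move=> u v; have [Puv|nPuv] := pselect (exists s, is_path G u v s).
    apply: (@best_unique v u); last by apply: best_rev; apply: PP.
    by apply: PP; case: Puv => s /(is_path_rev gG); exists (rev s).
  rewrite !P0 // => -[s /(is_path_rev gG) Ps].
  by apply: nPuv; exists (rev s).
- move=> u v x s /infixP[l [r E]].
  have [/PP|nPuv] := pselect (exists s, is_path G u v s).
    rewrite E => /best_infix bs; apply: best_unique (bs).
    by apply: PP; exists (x :: s); case: bs.
  by move: E; rewrite P0 //; case: (l).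
Qed.

End TieBreaking.

(** * Unordered pairs and filtered sequences *)

Lemma set2_inj (T : finType) (x y x' y' : T) :
  [set x; y]%SET = [set x'; y']%SET -> (x, y) = (x', y') \/ (x, y) = (y', x').
Proof.
move=> E; have [Hx Hy] : x \in [set x'; y']%SET /\ y \in [set x'; y']%SET.
  by rewrite -E !inE !eqxx orbT.
have [Hx' Hy'] : x' \in [set x; y]%SET /\ y' \in [set x; y]%SET.
  by rewrite E !inE !eqxx orbT.
move: Hx Hy Hx' Hy'; rewrite !inE.
case/orP=> /eqP-> /orP[]/eqP->; rewrite ?orbb; do ?by [left|right].
- by move=> _ /eqP->; left.
- by move=> /eqP-> _; left.
Qed.

Lemma filter_eq_cat (T : Type) (a : pred T) (t l r : seq T) :
  [seq x <- t | a x] = l ++ r ->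
  exists tl tr,
    [/\ t = tl ++ tr, [seq x <- tl | a x] = l & [seq x <- tr | a x] = r].
Proof.
elim: t l => [|x t IH] l /=; first by case: l r => // -[] // _; exists [::], [::].
case: l => [|y l]; first by move=> E; exists [::], (x :: t).
case: ifP => ax.
  by case=> <- /IH[tl [tr [-> <- <-]]]; exists (x :: tl), tr; rewrite /= ax.
by move=> /(IH (y :: l))[tl [tr [-> <- <-]]]; exists (x :: tl), tr; rewrite /= ax.
Qed.

Lemma filter_eq_cons (T : Type) (a : pred T) (t r : seq T) x :
  [seq x <- t | a x] = x :: r ->
  exists tl tr,
    [/\ t = tl ++ x :: tr, [seq x <- tl | a x] = [::],
        [seq x <- tr | a x] = r & a x].
Proof.
elim: t => //= y t IH; case: ifP => ay.
  by case=> <- <-; exists [::], t.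
by case/IH=> tl [tr [-> E1 E2 ax]]; exists (y :: tl), tr; rewrite /= ay.
Qed.

(** A segment of the filtered sequence is lifted to one of t with the same two ends; this is how
    consistency will pass from paths to their traces. *)
Lemma filter_eq_infix (T : Type) (a : pred T) (t l s r : seq T) x :
  [seq x <- t | a x] = l ++ (x :: s) ++ r ->
  exists tl m tr, [/\ t = tl ++ (x :: m) ++ tr,
    [seq x <- x :: m | a x] = x :: s & last x m = last x s].
Proof.
move=> H; have [t1 [t2 [-> _ H2]]] := filter_eq_cat H.
have [t3 [t4 [-> _ E ax]]] := filter_eq_cons (r := s ++ r) H2.
case/lastP: s E {H H2} => [|s y] E.
  by exists (t1 ++ t3), [::], t4; rewrite /= ax -catA.
rewrite -cats1 -catA in E; have [m [t5 [-> Es H5]]] := filter_eq_cat E.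
have [t6 [t7 [-> E6 _ ay]]] := filter_eq_cons (r := r) H5.
exists (t1 ++ t3), (m ++ rcons t6 y), t7.
rewrite last_cat last_rcons last_rcons /= ax filter_cat Es filter_rcons E6 ay.
by rewrite cats1 -[in RHS]catA -(catA m) cat_rcons.
Qed.

(** * Deletions as sequences of minor operations *)

Section TerminalMinor.
Variables (T : finType) (A : {set T}).
Implicit Types (S : sgraph T) (V : {set T}) (E : {set {set T}}).

(** Induction on the number of edges outside E: one of them is put back, and deleted last. *)
Lemma terminal_minor_edges S E :
  E \subset eset S -> terminal_minor A S (SGraph (vset S) E).
Proof.
have [n] := ubnP #|eset S :\: E|; elim: n E => // n IH E.
rewrite ltnS => leE sE; have [/eqP|[e eD]] := set_0Vmem (eset S :\: E).
  rewrite finset.setD_eq0 => sE'.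
  have -> : E = eset S by apply/eqP; rewrite finset.eqEsubset sE.
  by case: (S) => *; apply: MinorRefl.
have [eE eS] : e \notin E /\ e \in eset S by move: eD; rewrite inE => /andP[].
have -> : SGraph (vset S) E = del_edge e (SGraph (vset S) (e |: E)).
  by rewrite /del_edge /= finset.setU1K.
apply: (MinorTrans (S1 := SGraph (vset S) (e |: E)%SET)).
  apply: IH; last by rewrite finset.subUset finset.sub1set eS.
  apply: leq_trans leE; rewrite [leqRHS](cardsD1 e) eD ltnS subset_leq_card //.
  by apply/fintype.subsetP=> f; rewrite !inE negb_or -andbA.
by apply: MinorDelEdge; rewrite /= !inE eqxx.
Qed.

(** As all edges lie inside V, deleting a vertex outside V removes no edge; such a vertex is not a
    terminal. *)
Lemma terminal_minor_vertices S0 S V :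
  terminal_minor A S0 S -> A \subset V -> V \subset vset S ->
  (forall e, e \in eset S -> e \subset V) ->
  terminal_minor A S0 (SGraph V (eset S)).
Proof.
move=> minS sAV; have [n] := ubnP #|vset S :\: V|; elim: n V sAV => // n IH V.
rewrite ltnS => sAV leV sV eV; have [/eqP|[v vD]] := set_0Vmem (vset S :\: V).
  rewrite finset.setD_eq0 => sV'.
  have -> : V = vset S by apply/eqP; rewrite finset.eqEsubset sV.
  by case: (S) minS.
have [vV vS] : v \notin V /\ v \in vset S by move: vD; rewrite inE => /andP[].
have -> : SGraph V (eset S) = del_vertex v (SGraph (v |: V) (eset S)).
  rewrite /del_vertex /= finset.setU1K //; congr SGraph.
  apply/setP=> e; rewrite inE; case: (boolP (e \in eset S)) => //= eS.
  by apply/esym; apply: contra vV; apply/fintype.subsetP/eV.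
apply: (MinorTrans (S1 := SGraph (v |: V)%SET (eset S))).
  apply: IH.
  - by apply: fintype.subset_trans sAV (finset.subsetUr _ _).
  - apply: leq_trans leV; rewrite [leqRHS](cardsD1 v) vD ltnS subset_leq_card //.
    by apply/fintype.subsetP=> f; rewrite !inE negb_or -andbA.
  - by rewrite finset.subUset finset.sub1set vS.
  - by move=> e /eV /fintype.subset_trans; apply; apply: finset.subsetUr.
apply: MinorDelVertex; first by rewrite /= !inE eqxx.
by apply: contra vV; apply/fintype.subsetP.
Qed.

End TerminalMinor.

(** * Selected paths, their traces, and the loop invariant *)

Section Reduction.
Variables (R : realType) (T : finType) (G : graph R T) (A : {set T}).
Variable P : T -> T -> seq T.
Hypotheses (gG : is_graph G) (sAG : A \subset vset G).
Hypothesis cP : consistent_shortest_paths G P.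
Implicit Types (H : graph R T) (W : {set T}) (a b c d u v w x y z : T).
Implicit Types (l r p q s t : seq T) (e f : {set T}).

Lemma selected_path u v : P u v <> [::] -> is_path G u v (P u v).
Proof.
case: cP => sP P0 _ _ nP; have [/sP[]//|/P0//] := pselect (exists s, is_path G u v s).
Qed.

Lemma selected_exists u v s : is_path G u v s -> is_path G u v (P u v).
Proof. by case: cP => sP _ _ _ Ps; case: (sP u v) => //; exists s. Qed.

Lemma dist_selected u v : is_path G u v (P u v) -> dist G u v = (path_len G (P u v))%:E.
Proof. by case: cP => sP _ _ _ Ps; case: (sP u v) => //; exists (P u v). Qed.

Lemma dist_unconnected u v : P u v = [::] -> dist G u v = +oo%E.
Proof.
move=> P0; rewrite /dist (_ : image _ _ = set0%classic) ?ereal_inf0 //.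
apply/seteqP; split=> // x [s /selected_exists Ps _].
by move: Ps; rewrite P0.
Qed.

Lemma fine_dist u v : fine (dist G u v) = path_len G (P u v).
Proof.
have [P0|/eqP/selected_path Puv] := eqVneq (P u v) [::].
  (* For an unconnected pair, [fine] of infinity and the empty sum are both 0. *)
  by rewrite dist_unconnected // P0 /path_len big_nil.
by rewrite dist_selected.
Qed.

Lemma selected_uniq u v : uniq (P u v).
Proof.
by have [->//|/eqP/selected_path/is_pathP[p []]] := eqVneq (P u v) [::].
Qed.

Lemma selected_rev u v : P v u = rev (P u v).
Proof. by case: cP. Qed.

Lemma selected_infix u v l x s r :
  P u v = l ++ (x :: s) ++ r -> P x (last x s) = x :: s.
Proof. by case: cP => _ _ _ I E; apply: (I u v); apply/infixP; exists l, r. Qed.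

Lemma selected_len_sym u v : path_len G (P u v) = path_len G (P v u).
Proof. by rewrite (selected_rev u v) path_len_rev. Qed.

Lemma selected_len_ge0 u v : 0 <= path_len G (P u v).
Proof.
have [->|/eqP/selected_path/is_pathP[p [-> _ Ep _ _]]] := eqVneq (P u v) [::].
  by rewrite /path_len big_nil.
rewrite /path_len big_seq; apply: sumr_ge0 => e ep.
by move: Ep; rewrite adj_path_edges => /allP/(_ _ ep)/gG[].
Qed.

(** By consistency the three selected paths are segments of [P a b], and the one from x to z is the
    other two joined at y. *)
Lemma selected_len_add a b x y z :
  subseq [:: x; y; z] (P a b) ->
  path_len G (P x z) = path_len G (P x y) + path_len G (P y z).
Proof.
have cons_split t t' m : subseq (m :: t) t' ->
    exists l r, t' = l ++ m :: r /\ subseq t r.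
  elim: t' => //= n t' IH; case: eqP => [->|_ /IH[l [r [-> str]]]].
    by move=> ?; exists [::], t'.
  by exists (n :: l), r.
case/cons_split=> l [r [E /cons_split[m [r' [Er /cons_split[n [r'' [Er' _]]]]]]]].
have Exz : P x z = x :: m ++ y :: rcons n z.
  have := @selected_infix a b l x (m ++ y :: rcons n z) r''.
  rewrite last_cat /= last_rcons E Er Er'; apply.
  by rewrite /= -catA /= cat_rcons.
have Exy : P x y = x :: rcons m y.
  have := @selected_infix a b l x (rcons m y) r'.
  by rewrite last_rcons E Er; apply; rewrite /= cat_rcons.
have Eyz : P y z = y :: rcons n z.
  have := @selected_infix a b (l ++ x :: m) y (rcons n z) r''.
  by rewrite last_rcons E Er Er' -catA /= cat_rcons; apply.
rewrite Exz Exy Eyz -cat_cons /path_len path_edges_cat big_cat /=.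
by rewrite -cats1.
Qed.

(** The path that [P a b] becomes once the vertices outside W have been bypassed. *)
Definition trace W a b := [seq x <- P a b | x \in W].

Lemma trace_uniq W a b : uniq (trace W a b).
Proof. exact/filter_uniq/selected_uniq. Qed.

Lemma trace_rev W a b : trace W b a = rev (trace W a b).
Proof. by rewrite /trace selected_rev filter_rev. Qed.

Lemma trace_infix W a b l x s r :
  trace W a b = l ++ (x :: s) ++ r -> trace W x (last x s) = x :: s.
Proof.
move=> Et; have [tl [m [tr [E Em <-]]]] :=
  @filter_eq_infix _ (fun z => z \in W) _ _ _ _ _ Et.
by rewrite /trace (selected_infix E).
Qed.

Lemma trace_ends W a b :
  a \in W -> b \in W -> head a (trace W a b) = a /\ last b (trace W a b) = b.
Proof.
move=> aW bW; rewrite /trace.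
have [->//|/eqP/selected_path/is_pathP[p [-> _ _ Lp _]]] := eqVneq (P a b) [::].
split; first by rewrite /= aW.
by rewrite lastI Lp filter_rcons bW last_rcons.
Qed.

Lemma trace_D1 W v a b : trace (W :\ v) a b = [seq x <- trace W a b | x != v].
Proof. by rewrite /trace -filter_predI; apply: eq_filter => x; rewrite !inE. Qed.

Lemma trace_segment W a b x y :
  x \in trace W a b -> y \in trace W a b -> x != y ->
  exists l r, trace W a b = l ++ trace W x y ++ r \/
              trace W a b = l ++ rev (trace W x y) ++ r.
Proof.
have ordered l m r x' y' : trace W a b = l ++ x' :: m ++ y' :: r ->
    trace W a b = l ++ trace W x' y' ++ r.
  move=> E; have := @trace_infix W a b l x' (rcons m y') r.
  by rewrite last_rcons E => -> //=; rewrite cat_rcons.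
move=> xQ; case/splitPr: {-1}_ / xQ (erefl (trace W a b)) => l r E.
rewrite mem_cat inE => /or3P[/splitPr El|/eqP->|/splitPr Er]; last 2 first.
- by rewrite eqxx.
- move=> _; case: Er E => r1 r2 E; exists l, r2; left; rewrite -E.
  exact: ordered E.
move=> _; case: El E => l1 l2; rewrite -catA => E; exists l1, r; right.
by rewrite -trace_rev -E; apply: ordered E.
Qed.

(** The part of the first trace between x and y passes through u, v, w. By consistency the second
    trace contains the same part, possibly reversed, so it has the same neighbours at v. *)
Lemma trace_agree W a b c d l u v w r x y :
  trace W a b = l ++ [:: u, v, w & r] -> x \in rcons l u -> y \in w :: r ->
  x \in trace W c d -> y \in trace W c d ->
  exists l' r', trace W c d = l' ++ [:: u, v, w & r'] \/
                trace W c d = l' ++ [:: w, v, u & r'].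
Proof.
move=> E xl yr xQ yQ.
have [i [n Exy]] : exists i n, trace W x y = i ++ [:: u, v, w & n].
  have [l1 [i El]] : exists l1 i, rcons l u = l1 ++ rcons i u /\ head u i = x.
    case/splitPr: {-1}_ / xl (erefl (rcons l u)) => l1 l2.
    case/lastP: l2 => [|l2 u']; rewrite ?cats1 -?rcons_cons -?rcons_cat.
      by move/rcons_inj=> [_ <-]; exists l1, [::]; rewrite cats1.
    by move/rcons_inj=> [_ <-]; exists l1, (x :: l2); rewrite -rcons_cat.
  have [n [r2 Er]] : exists n r2, w :: r = (w :: n) ++ r2 /\ last w n = y.
    case/splitPr: {-1}_ / yr (erefl (w :: r)) => r1 r2.
    case: r1 => [|w' r1] [<- Er]; first by exists [::], r2.
    by exists (rcons r1 y), r2; rewrite last_rcons /= cat_rcons.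
  case: El Er => El Ei [Er En]; exists i, n.
  case: i El Ei => [|x' i] El /= Ei.
    have := @trace_infix W a b l1 u [:: v, w & n] r2.
    rewrite /= En Ei; apply.
    by rewrite E -cat_rcons El -Ei -catA /= Er.
  have := @trace_infix W a b l1 x' (i ++ [:: u, v, w & n]) r2.
  rewrite last_cat /= En Ei; apply.
  by rewrite E -cat_rcons El -Ei -catA /= cat_rcons -catA /= Er.
have xy : x != y.
  have := trace_uniq W a b; rewrite E -cat_rcons cat_uniq => /and3P[_ /hasPn U _].
  have {U} := U y; rewrite inE yr orbT => /(_ isT); apply: contra => /eqP<-.
  by [].
have [l' [r' []]] := trace_segment xQ yQ xy; rewrite Exy => ->.
  by exists (l' ++ i), (n ++ r'); left; rewrite -!catA.
exists (l' ++ rev n), (rev i ++ r'); right.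
by rewrite rev_cat !rev_cons -!cats1 -!catA.
Qed.

(* Contracting an edge at a vertex of degree two bypasses that vertex on every
   selected path, so this shape is kept along the loop. *)
Definition carried H :=
  [/\ A \subset vset H,
      forall x, x \in vset H -> x \in vset G /\
        (x \in A \/ exists a b, [/\ a \in A, b \in A & x \in P a b]),
      forall e, e \in eset H <-> exists a b,
        [/\ a \in A, b \in A & e \in path_edges (trace (vset H) a b)] &
      forall x y, [set x; y]%SET \in eset H ->
        len H [set x; y]%SET = path_len G (P x y)].

(** The ends of an edge are consecutive on a trace, which by consistency makes their own trace, and
    so their selected path, nonempty. *)
Lemma carried_edge H x y : carried H -> [set x; y]%SET \in eset H ->
  [/\ x \in vset H, y \in vset H, x != y & is_path G x y (P x y)].
Proof.
case=> _ _ EH _ /EH[a [b [_ _ /[dup] He /mem_path_edges[l [x' [y' [r [E]]]]]]]].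
have xW z : z \in [set x; y]%SET -> z \in vset H.
  by move/(path_edges_mem He); rewrite mem_filter => /andP[].
have := card_path_edges (trace_uniq _ _ _) He; rewrite cards2.
case: eqP => // xy _ Exy; split; rewrite ?xW ?inE ?eqxx ?orbT //.
have nz z z' : trace (vset H) z z' = [:: z; z'] -> P z z' <> [::].
  by rewrite /trace => + E0; rewrite E0.
have Exy' : trace (vset H) x' y' = [:: x'; y'].
  by apply: (@trace_infix _ a b l x' [:: y'] r).
apply/selected_path/nz.
by case: (set2_inj Exy) => -[-> ->] //; rewrite trace_rev Exy'.
Qed.

(** Each edge of H is expanded into the selected path between its ends, which has the same
    length. *)
Lemma carried_walk H x p : carried H -> x \in vset G -> path (adj H) x p ->
  exists q, [/\ path (adj G) x q, last x q = last x p &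
                path_len G (x :: q) = path_len H (x :: p)].
Proof.
move=> cH; elim: p x => [|y p IH] x xG.
  by exists [::]; rewrite /path_len !big_nil.
case/andP=> xy Ep; have [_ yW _ Pxy] := carried_edge cH xy.
have lxy : len H [set x; y]%SET = path_len G (P x y) by case: cH => _ _ _ ->.
have [_ sHG _ _] := cH; have [yG _] := sHG _ yW.
have [q [Eq Lq lq]] := IH y yG Ep.
case/is_pathP: Pxy lxy => q0 [-> _ Eq0 Lq0 _] lxy; exists (q0 ++ q).
rewrite cat_path last_cat Lq0 Eq0 Eq Lq; split=> //.
have := @path_len_infix _ _ G [::] x q0 q; rewrite Lq0 /= => ->.
rewrite lq -lxy {1}/path_len big_nil add0r.
by rewrite [RHS]/path_len path_edges_cons2 big_cons.
Qed.

Lemma carried_dist_ge H u v : carried H -> (dist G u v <= dist H u v)%E.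
Proof.
move=> cH; apply: le_ereal_inf_tmp => _ [s /is_pathP[p [-> uH Ep <- _]] <-].
have [_ sHG _ _] := cH; have [uG _] := sHG _ uH.
have [q [Eq Lq <-]] := carried_walk cH uG Ep.
have [t Pt [Lt _]] := walk_to_path gG uG Eq; rewrite -Lq.
apply: (@le_trans _ _ (path_len G t)%:E); last by rewrite lee_fin.
by apply: ereal_inf_lbound; exists t.
Qed.

(** The edges join vertices met in order along [P a b], so their lengths, being distances in G, add
    up by [selected_len_add]. *)
Lemma carried_len_subseq H a b x p : carried H -> path (adj H) x p ->
  subseq (x :: p) (P a b) -> path_len H (x :: p) = path_len G (P x (last x p)).
Proof.
move=> cH; elim: p x => [|y p IH] x.
  move=> _ /mem_subseq/(_ x); rewrite inE eqxx => /(_ isT) xP.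
  have [l [r Eab]] : exists l r, P a b = l ++ x :: r.
    by case/splitPr: {-1}_ / xP (erefl (P a b)) => l r E; exists l, r.
  by rewrite (@selected_infix a b l x [::] r) // /path_len !big_nil.
case/andP=> xy Ep sub; have [_ _ _ lH] := cH.
rewrite {1}/path_len path_edges_cons2 big_cons lH // -/(path_len H _).
have sub' := subseq_trans (subseq_cons _ _) sub.
rewrite (IH y Ep sub') /=.
(* A single edge is treated apart, since [selected_len_add] needs three positions on the path. *)
have [p0|pn] := eqVneq p [::].
  have := IH y Ep sub'; rewrite p0 /= => <-.
  by rewrite /path_len big_nil addr0.
apply/esym/(@selected_len_add a b); apply: subseq_trans sub.
rewrite /= !eqxx sub1seq; case: (p) pn => //= z p' _.
exact: mem_last.
Qed.

Lemma carried_trace_path H a b : carried H -> a \in A -> b \in A ->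
  is_path G a b (P a b) -> is_path H a b (trace (vset H) a b).
Proof.
move=> [sAH _ EH _] aA bA /is_pathP[p [E _ _ Lp _]]; apply/is_pathP.
have aH := fintype.subsetP sAH _ aA; have bH := fintype.subsetP sAH _ bA.
have [_ Lb] := trace_ends aH bH.
exists [seq x <- p | x \in vset H].
have Et : trace (vset H) a b = a :: [seq x <- p | x \in vset H].
  by rewrite /trace E /= aH.
split=> //; last exact: trace_uniq.
  rewrite adj_path_edges -Et; apply/allP=> e He; apply/EH.
  by exists a, b.
by rewrite Et in Lb.
Qed.

(** Expanding paths of H gives one inequality; the trace from a to b, as long as [P a b], gives the
    other. *)
Lemma carried_dist H a b : carried H -> a \in A -> b \in A ->
  dist H a b = dist G a b.
Proof.
move=> cH aA bA; apply: le_anti; rewrite carried_dist_ge // andbT.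
have [P0|/eqP/selected_path Pab] := eqVneq (P a b) [::].
  by rewrite dist_unconnected // leey.
have PH := carried_trace_path cH aA bA Pab.
rewrite (dist_selected Pab); apply: ereal_inf_lbound.
exists (trace (vset H) a b) => //; congr _%:E.
have sub : subseq (trace (vset H) a b) (P a b) by apply: filter_subseq.
case/is_pathP: PH sub => p [-> _ Ep Lp _] sub.
by rewrite (carried_len_subseq cH Ep sub) Lp.
Qed.

Lemma carried_is_graph H : carried H -> is_graph H.
Proof.
move=> cH e eH; have [_ _ EH lH] := cH.
have [a [b [_ _ /mem_path_edges[_ [x [y [_ [_ Ee]]]]]]]] := (EH e).1 eH.
rewrite Ee in eH *; have [xH yH xy _] := carried_edge cH eH.
rewrite cards2 xy lH // selected_len_ge0; split=> //.
by rewrite finset.subUset !finset.sub1set xH.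
Qed.

Lemma carried_interior H a b v :
  carried H -> a \in A -> b \in A -> v \notin A -> v \in trace (vset H) a b ->
  exists l u w r, trace (vset H) a b = l ++ [:: u, v, w & r].
Proof.
move=> [sAH _ _ _] aA bA vA vQ.
have [Ha Hb] := trace_ends (fintype.subsetP sAH _ aA) (fintype.subsetP sAH _ bA).
by apply: (split_interior Ha Hb) => //; apply: contraNneq vA => ->.
Qed.


(** * Pruning, contraction steps and termination *)

Lemma carried_prune : carried (prune G A P).
Proof.
(* Pruning removes no vertex of a selected path between terminals, so initially the traces are the
   full paths. *)
have tE a b : a \in A -> b \in A -> trace (vset (prune G A P)) a b = P a b.
  move=> aA bA; apply/all_filterP/allP=> x xP; rewrite inE.
  have /(path_in_vset gG)/(_ _ xP)-> : is_path G a b (P a b).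
    by apply: selected_path => P0; rewrite P0 in xP.
  by apply/orP; right; apply/existsP; exists a; rewrite aA; apply/existsP;
     exists b; rewrite bA.
split.
- by apply/fintype.subsetP=> x xA; rewrite inE xA (fintype.subsetP sAG).
- move=> x; rewrite inE => /andP[-> xP]; split=> //.
  case/orP: xP => [->|/existsP[a /andP[aA /existsP[b /andP[bA xP]]]]]; first by left.
  by right; exists a, b.
- move=> e; rewrite inE; split.
    case/andP=> _ /existsP[a /andP[aA /existsP[b /andP[bA eP]]]].
    by exists a, b; rewrite tE.
  case=> a [b [aA bA]]; rewrite tE // => eP; apply/andP; split; last first.
    by apply/existsP; exists a; rewrite aA; apply/existsP; exists b; rewrite bA.
  have /is_pathP[p [Ep _ Pp _ _]] : is_path G a b (P a b).
    by apply: selected_path => P0; rewrite P0 in eP.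
  by move: Pp eP; rewrite adj_path_edges -Ep => /allP Pp /Pp.
- move=> x y; rewrite inE => /andP[xyG].
  case/existsP=> a /andP[aA /existsP[b /andP[bA /mem_path_edges]]].
  case=> l [x' [y' [r [E Exy]]]] /=.
  (* An edge of a selected path is itself a selected path, so its original length is already the
     distance. *)
  have Pxy' : P x' y' = [:: x'; y'] by apply: (@selected_infix a b l x' [:: y'] r).
  have lxy' : path_len G (P x' y') = len G [set x'; y']%SET.
    by rewrite Pxy' /path_len big_seq1.
  rewrite Exy -lxy'; case: (set2_inj Exy) => -[-> ->] //.
  exact: selected_len_sym.
Qed.

(** Deleting the edges first leaves the discarded vertices isolated. *)
Lemma prune_minor : terminal_minor A G (prune G A P).
Proof.
have [sAH sHG _ _] := carried_prune; have gH := carried_is_graph carried_prune.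
pose S := SGraph (vset G) (eset (prune G A P)).
apply: (@terminal_minor_vertices _ _ _ S) => //.
- apply: terminal_minor_edges.
  by apply/fintype.subsetP=> e; rewrite inE => /andP[].
- by apply/fintype.subsetP=> x /sHG[].
- by move=> e /gH[].
Qed.

(** The edge from v to u becomes a loop and is dropped, the one from v to w becomes {u, w}, possibly
    identified with an existing edge, and the others avoid v. *)
Lemma mem_contract H u v w e :
  is_graph H -> u != w ->
  [set f in eset H | v \in f]%SET = [set [set v; u]; [set v; w]]%SET ->
  (e \in eset (Defs.contract u v H)) =
  (e \in eset H) && (v \notin e) || (e == [set u; w]%SET).
Proof.
move=> gH uw Ev.
have inEv f : (f \in eset H) && (v \in f) = (f == [set v; u]%SET) || (f == [set v; w]%SET).
  by move/setP/(_ f): Ev; rewrite !inE.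
have /andP[vuH _] : ([set v; u]%SET \in eset H) && (v \in [set v; u]%SET).
  by rewrite inEv eqxx.
have /andP[vwH _] : ([set v; w]%SET \in eset H) && (v \in [set v; w]%SET).
  by rewrite inEv eqxx orbT.
have vw : w != v by have [] := gH _ vwH; rewrite cards2 eq_sym; case: eqP.
have vu : u != v by have [] := gH _ vuH; rewrite cards2 eq_sym; case: eqP.
have merge_id f : v \notin f -> Defs.merge u v @: f = f.
  move=> vf; rewrite -[RHS]imset_id; apply: eq_in_imset => x xf.
  by rewrite /Defs.merge; case: eqP => // xv; rewrite -xv xf in vf.
have merge_at x : x != v -> Defs.merge u v @: [set v; x]%SET = [set u; x]%SET.
  by move=> xv; rewrite imsetU1 imset_set1 /Defs.merge eqxx (negPf xv).
rewrite !inE; apply/andP/orP.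
- case=> /imsetP[f fH ->]; case: (boolP (v \in f)) => vf.
    have := inEv f; rewrite fH vf => /esym/orP[]/eqP->; rewrite merge_at //.
      by rewrite cards2 eqxx.
    by right.
  by move=> _; left; rewrite merge_id // fH.
- case=> [/andP[eH ve]|/eqP->].
    split; last by have [->] := gH _ eH.
    by apply/imsetP; exists e => //; rewrite merge_id.
  split; last by rewrite cards2 uw.
  by apply/imsetP; exists [set v; w]%SET; rewrite ?merge_at.
Qed.

Lemma carried_step H H' : carried H -> smooth_step G A H H' ->
  [/\ carried H', minor_step A H H' & (#|vset H'| < #|vset H|)%N].
Proof.
move=> cH [u v w vH vA uw Ev].
have gH := carried_is_graph cH; have [sAH sHG EH lH] := cH.
have inEv f : (f \in eset H) && (v \in f) = (f == [set v; u]%SET) || (f == [set v; w]%SET).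
  by move/setP/(_ f): Ev; rewrite !inE.
have /andP[vuH _] : ([set v; u]%SET \in eset H) && (v \in [set v; u]%SET).
  by rewrite inEv eqxx.
have /andP[vwH _] : ([set v; w]%SET \in eset H) && (v \in [set v; w]%SET).
  by rewrite inEv eqxx orbT.
(* The non-terminal v is interior to every trace through it, and its neighbours there can only be u
   and w. *)
have through a b : a \in A -> b \in A -> v \in trace (vset H) a b ->
    exists l u' w' r, trace (vset H) a b = l ++ [:: u', v, w' & r] /\
                      [set u'; w']%SET = [set u; w]%SET.
  move=> aA bA vQ; have [l [u' [w' [r E]]]] := carried_interior cH aA bA vA vQ.
  exists l, u', w', r; split=> //.
  have u'w' : u' != w'.
    have := trace_uniq (vset H) a b; rewrite E cat_uniq => /and3P[_ _].
    by rewrite /= !inE !negb_or => /andP[/and3P[]].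
  have nb z : [set v; z]%SET \in path_edges (trace (vset H) a b) -> z = u \/ z = w.
    move=> zQ; have zH : [set v; z]%SET \in eset H by apply/EH; exists a, b.
    have := inEv [set v; z]%SET; rewrite zH !inE eqxx => /esym/orP[]/eqP/set2_inj.
      by case=> -[]; [left|move=> <- ->; left].
    by case=> -[]; [right|move=> <- ->; right].
  have : u' = u \/ u' = w.
    by apply: nb; rewrite E finset.setUC mem_path_edges_cat2.
  have : w' = u \/ w' = w.
    by apply: nb; rewrite E -cat_rcons mem_path_edges_cat2.
  by case=> Ew [] Eu; move: u'w'; rewrite Ew Eu ?eqxx // finset.setUC.
split; last 2 first.
- by apply: MinorContract; rewrite // finset.setUC.
- by rewrite /= [ltnRHS](cardsD1 v) vH.
split=> /=.
- apply/fintype.subsetP=> x xA; rewrite !inE (fintype.subsetP sAH) // andbT.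
  by apply: contraNneq vA => <-.
- by move=> x; rewrite !inE => /andP[_ /sHG].
- move=> e; rewrite (mem_contract _ gH uw Ev); split.
    case/orP=> [/andP[/EH[a [b [aA bA eQ]]] ve]|/eqP->].
      exists a, b; split=> //; rewrite trace_D1.
      case: (boolP (v \in trace (vset H) a b)) => [/(through _ _ aA bA)|vQ].
        case=> l [u' [w' [r [E _]]]]; rewrite E path_edges_bypass -?E ?eQ ?ve ?orbT //.
        exact: trace_uniq.
      rewrite (_ : [seq x <- _ | _] = trace (vset H) a b) //.
      by apply/all_filterP/allP=> x xQ; apply: contraNneq vQ => <-.
    (* The new edge lies on any trace that used the edge from v to w. *)
    have [a [b [aA bA vwQ]]] := (EH _).1 vwH; exists a, b; split=> //.
    have [l [u' [w' [r [E <-]]]]] := through _ _ aA bA (path_edges_mem vwQ (finset.set21 _ _)).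
    by rewrite trace_D1 E path_edges_bypass ?eqxx // -E trace_uniq.
  case=> a [b [aA bA]]; rewrite trace_D1.
  case: (boolP (v \in trace (vset H) a b)) => [/(through _ _ aA bA)|vQ].
    case=> l [u' [w' [r [E Euw]]]]; rewrite E path_edges_bypass -?E ?trace_uniq //.
    rewrite Euw orbC => /orP[/andP[eQ ->]|->]; last by rewrite orbT.
    by rewrite andbT; apply/orP; left; apply/EH; exists a, b.
  rewrite (_ : [seq x <- _ | _] = trace (vset H) a b); last first.
    by apply/all_filterP/allP=> x xQ; apply: contraNneq vQ => <-.
  move=> eQ; apply/orP; left; apply/andP; split; first by apply/EH; exists a, b.
  by apply: contra vQ; apply: path_edges_mem.
- move=> x y; rewrite (mem_contract _ gH uw Ev) => /orP[/andP[xyH _]|/eqP Exy].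
    (* If {u, w} was already an edge, the length assigned to it is the distance it had before. *)
    case: eqP => [Exy|_]; last exact: lH.
    rewrite fine_dist.
    by case: (set2_inj Exy) => -[-> ->] //; apply: selected_len_sym.
  rewrite Exy eqxx fine_dist.
  by case: (set2_inj Exy) => -[-> ->] //; apply: selected_len_sym.
Qed.

(** The minor claim is an implication because minor operations are appended at the end, while the
    loop unfolds from its first step. *)
Lemma carried_loop H H' : carried H -> smooth_loop G A H H' ->
  [/\ carried H', terminal_minor A G H -> terminal_minor A G H' &
      forall H'', ~ smooth_step G A H' H''].
Proof.
move=> cH loop; elim: loop cH => {H H'} [H noH cH|H H1 H2 step _ IH cH]; first by [].
have [cH1 mH1 _] := carried_step cH step; have [cH2 mH2 noH2] := IH cH1.
by split=> // mH; apply: mH2; apply: MinorTrans mH1.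
Qed.

(** Each contraction removes a vertex, so iterating must stop. *)
Lemma smooth_loop_exists H : carried H -> exists H', smooth_loop G A H H'.
Proof.
have [n] := ubnP #|vset H|; elim: n H => // n IH H; rewrite ltnS => leH cH.
have [[H1 step]|no] := pselect (exists H1, smooth_step G A H H1).
  have [cH1 _ ltH] := carried_step cH step.
  have [H2 loop] := IH _ (leq_trans ltH leH) cH1.
  by exists H2; apply: SmoothIter step loop.
by exists H; apply: SmoothExit => H1 step; apply: no; exists H1.
Qed.

(* At a vertex of degree other than two, two selected paths must diverge, so
   the vertex is the first or the last one that they share. *)
Definition divergence W (i : (T * T) * (T * T) * bool) :=
  let: (a, b, (c, d), last_one) := i in
  let s := [seq x <- trace W a b | x \in trace W c d] in
  if last_one then last a s else head a s.

Lemma carried_exit H : carried H -> (forall H', ~ smooth_step G A H H') ->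
  vset H :\: A \subset divergence (vset H) @:
    finset.setX (finset.setX (finset.setX A A) (finset.setX A A)) [set: bool]%SET.
Proof.
move=> cH no; have [_ sHG EH _] := cH.
apply/fintype.subsetP=> v; rewrite inE => /andP[vA vH].
have [a [b [aA bA vP]]] : exists a b, [/\ a \in A, b \in A & v \in P a b].
  by have [_ []] := sHG _ vH; first by rewrite (negPf vA).
have vQ : v \in trace (vset H) a b by rewrite mem_filter vH.
have [l [u [w [r E]]]] := carried_interior cH aA bA vA vQ.
have U := trace_uniq (vset H) a b; rewrite E in U.
have uw : u != w.
  move: U; rewrite cat_uniq => /and3P[_ _].
  by rewrite /= !inE !negb_or => /andP[/and3P[]].
have vuH : [set v; u]%SET \in eset H.
  by apply/EH; exists a, b; rewrite E finset.setUC mem_path_edges_cat2.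
have vwH : [set v; w]%SET \in eset H.
  by apply/EH; exists a, b; rewrite E -cat_rcons mem_path_edges_cat2.
(* If the edges to u and w were the only ones at v, another contraction would be possible. *)
have [e [eH ve eu ew]] : exists e,
    [/\ e \in eset H, v \in e, e <> [set v; u]%SET & e <> [set v; w]%SET].
  apply: contrapT => none; apply: no; constructor; try eassumption.
  apply/setP=> e; rewrite !inE; apply/andP/orP => [[eH ve]|[]/eqP->]; last 2 first.
  - by rewrite vuH finset.set21.
  - by rewrite vwH finset.set21.
  have [|eu] := eqVneq e [set v; u]%SET; first by left.
  have [|ew] := eqVneq e [set v; w]%SET; first by right.
  by case: none; exists e; split=> //; apply/eqP.
have [c [d [cA dA eQ]]] := (EH e).1 eH.
have vQ' := path_edges_mem eQ ve.
(* A shared vertex on each side of v would force the second trace through u, v, w, leaving no room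
   for the third edge e at v. *)
have diverge x y : x \in rcons l u -> y \in w :: r ->
    x \in trace (vset H) c d -> y \in trace (vset H) c d -> False.
  move=> xl yr xQ yQ; have [l' [r' Q]] := trace_agree E xl yr xQ yQ.
  have U' := trace_uniq (vset H) c d.
  by case: Q => Q; rewrite Q in U' eQ; case: (path_edges_at U' eQ ve).
have side (s : seq T) : (exists2 x, x \in s & x \in trace (vset H) c d) \/
    [seq x <- s | x \in trace (vset H) c d] = [::].
  have [/hasP[x xs xQ]|] := boolP (has [in trace (vset H) c d] s); first by left; exists x.
  by rewrite has_filter negbK => /eqP; right.
have Es : [seq x <- trace (vset H) a b | x \in trace (vset H) c d] =
    [seq x <- rcons l u | x \in trace (vset H) c d] ++
    v :: [seq x <- w :: r | x \in trace (vset H) c d].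
  by rewrite E -cat_rcons filter_cat /= vQ'.
have mem_i k : ((a, b), (c, d), k) \in
    finset.setX (finset.setX (finset.setX A A) (finset.setX A A)) [set: bool]%SET.
  by rewrite !inE aA bA cA dA.
(* If something is shared before v, nothing is shared after it and v is the last shared vertex;
   otherwise v is the first. *)
have [[x xl xQ]|Eh] := side (rcons l u).
  have [[y yr yQ]|El] := side (w :: r); first by case: (diverge x y).
  apply/imsetP; exists ((a, b), (c, d), true); rewrite ?mem_i //.
  by rewrite /divergence Es El last_cat.
apply/imsetP; exists ((a, b), (c, d), false); rewrite ?mem_i //.
by rewrite /divergence Es Eh.
Qed.

(** Four terminals and a boolean give at most 2 k^4 non-terminals; the k terminals add at most k^4
    more. *)
Lemma carried_card H : carried H -> (forall H', ~ smooth_step G A H H') ->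
  (#|vset H| <= 3 * #|A| ^ 4)%N.
Proof.
move=> cH /(carried_exit cH)/subset_leq_card leD.
have {leD} : (#|vset H :\: A| <= 2 * #|A| ^ 4)%N.
  apply: leq_trans leD (leq_trans (leq_imset_card _ _) _).
  by rewrite !cardsX cardsT card_bool mulnC !expnS expn0 muln1 !mulnA.
rewrite -(cardsID A (vset H)) mulSn => leD; apply: leq_add leD.
apply: (leq_trans (subset_leq_card (finset.subsetIr _ _))).
by case: #|A| => // k; rewrite -{1}[k.+1]expn1 leq_pexp2l.
Qed.

End Reduction.

(** * The procedure as a whole and the bound on f* *)

Lemma reduce_exists (R : realType) (T : finType) (G : graph R T) (A : {set T}) :
  is_graph G -> A \subset vset G -> exists G', reduce_graph_naive G A G'.
Proof.
move=> gG sAG; have [P cP] := consistent_shortest_paths_exist gG.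
have [G' loop] := smooth_loop_exists gG cP (carried_prune gG sAG cP).
by exists G', P.
Qed.

Lemma reduce_correct (R : realType) (T : finType) (G : graph R T) (A : {set T})
    (G' : graph R T) :
  is_graph G -> A \subset vset G -> reduce_graph_naive G A G' ->
  distance_preserving_minor G A G' /\ (#|vset G'| <= 3 * #|A| ^ 4)%N.
Proof.
move=> gG sAG [P cP loop].
have [cG' mG' noG'] := carried_loop gG cP (carried_prune gG sAG cP) loop.
split; last exact: (carried_card cP cG' noG').
split.
- exact: (carried_is_graph gG cP cG').
- exact/mG'/(prune_minor gG sAG cP).
- by case: cG'.
- by move=> u v; apply: (carried_dist gG cP cG').
Qed.

Theorem theorem3 (R : realType) :
  exists C : R, 0 < C /\
    (forall (T : finType) (G : graph R T) (A : {set T}),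
       is_graph G -> A \subset vset G ->
       (exists G' : graph R T, reduce_graph_naive G A G') /\
       (forall G' : graph R T, reduce_graph_naive G A G' ->
          distance_preserving_minor G A G' /\
          #|vset G'|%:R <= C * #|A|%:R ^+ 4)) /\
    (forall k : nat, (1 <= k)%N ->
       exists2 m : nat, is_fstar R k m & m%:R <= C * k%:R ^+ 4).
Proof.
exists 3%:R; split; first by rewrite ltr0n.
split=> [T G A gG sAG|k _].
  split=> [|G' /(reduce_correct gG sAG)[]]; first exact: reduce_exists.
  by rewrite -natrX -natrM ler_nat.
have bound : minor_size_bound R k (3 * k ^ 4).
  move=> T G A gG sAG <-; have [G' redG'] := reduce_exists gG sAG.
  by have [? ?] := reduce_correct gG sAG redG'; exists G'.
(* The value f*(k) is the least element of a nonempty set of naturals, made decidable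
   classically. *)
have ex_bound : exists m, `[< minor_size_bound R k m >].
  by exists (3 * k ^ 4)%N; apply/asboolP.
have [m /asboolP mb min_m] := ex_minnP ex_bound.
exists m; first by split=> // m' /asboolP; apply: min_m.
by rewrite -natrX -natrM ler_nat min_m //; apply/asboolP.
Qed.
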